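(* Let $x:[0,T]\to\mathbb{R}^d$ be the exact solution of $\dot x(t)=Ax(t)+f(x(t))$, where $A\in\mathbb{R}^{d\times d}$ and $f:\mathbb{R}^d\to\mathbb{R}^d$. Let $h>0$, $t_n=nh$, and let $(x_n)_{0\le nh\le T}$ be a numerical solution satisfying the EKahan scheme $$x_{n+1}=e^{hA}x_n+h\,\phi(hA)\Bigl(-\tfrac12 f(x_n)+2f\bigl(\tfrac{x_n+x_{n+1}}{2}\bigr)-\tfrac12 f(x_{n+1})\Bigr).$$ Assume that there is a convex bounded set $\mathcal D\subset\mathbb{R}^d$ containing $\{x(t):t\in[0,T]\}$ and $\{x_n:0\le nh\le T\}$, that $f$ is Lipschitz on $\mathcal D$ with constant $L>0$, and that the local truncation error $\tau_{n+1}$ satisfies $\|\tau_{n+1}\|\le C_{\rm loc}h^3$ for all $n\ge 0$ with $(n+1)h\le T$. Then there exist constants $C_1,C_2>0$, depending only on $\|A\|$, $L$, $T$, $M_E$, $M_\phi$ and $C_{\rm loc}$, such that, whenever $$h\le h_0:=\frac{1}{3LM_\phi},$$ one has $$\|x(t_n)-x_n\|\le e^{C_1T}\bigl(\|x(t_0)-x_0\|+C_2h^2\bigr),\qquad 0\le nh\le T.$$ In particular, if $x_0=x(t_0)$, then $\max_{0\le nh\le T}\|x(t_n)-x_n\|=O(h^2)$.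
   Context: $\|\cdot\|$ denotes a vector norm on $\mathbb{R}^d$ and the induced matrix norm. $\phi(z)=\frac{e^z-1}{z}$ (entire function, $\phi(0)=1$), applied to matrices through its power series. $T>0$ is a fixed final time, and $M_E=\max_{0\le t\le T}\|e^{tA}\|$, $M_\phi=\max_{0\le t\le T}\|\phi(tA)\|$. The local truncation error $\tau_{n+1}$ is the residual of the exact solution in the scheme: $$x(t_{n+1})=e^{hA}x(t_n)+h\phi(hA)\Bigl(-\tfrac12 f(x(t_n))+2f\bigl(\tfrac{x(t_n)+x(t_{n+1})}{2}\bigr)-\tfrac12 f(x(t_{n+1}))\Bigr)+\tau_{n+1}.$$ *)

(* Defs.v *)
From HB Require Import structures.
From mathcomp Require Import all_boot all_order all_algebra.
From mathcomp Require Import all_classical all_reals all_analysis.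
Import Order.TTheory GRing.Theory Num.Theory.
Import numFieldNormedType.Exports.

Set Implicit Arguments.
Unset Strict Implicit.
Unset Printing Implicit Defensive.

Local Open Scope classical_set_scope.
Local Open Scope ring_scope.

Section MatrixFunctions.
Context {R : realType}.

(* All norms on matrices over R of a given size define the same topology, so
   the limit does not depend on the entrywise topology of the library. *)
Definition mx_pseries (a : nat -> R) (d : nat) (A : 'M[R]_d) : 'M[R]_d :=
  limn (series (fun k => a k *: A ^+ k)).

Definition mx_exp (d : nat) (A : 'M[R]_d) : 'M[R]_d :=
  mx_pseries (fun k => k`!%:R^-1) A.

Definition phi (z : R) : R := if z == 0 then 1 else (expR z - 1) / z.

Definition phi_coeff (k : nat) : R := k.+1`!%:R^-1.

(* phi_coeff are the coefficients of the power series of phi. *)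
Lemma cvg_pseries_phi (z : R) : pseries phi_coeff z @ \oo --> phi z.
Proof.
rewrite /phi; case: eqVneq => [->|z0].
  rewrite -cvg_shiftS; apply: cvg_near_cst; apply: nearW => n.
  rewrite /pseries/series/= big_nat_recl// expr0 big1 ?addr0.
    by rewrite /phi_coeff factS mul1n invr1 mulr1.
  by move=> i _; rewrite expr0n/= mulr0.
have -> : pseries phi_coeff z
    = (fun n => (series (exp_coeff z) n.+1 - 1) / z).
  apply/funext => n; rewrite [in RHS]/series/= big_nat_recl//.
  rewrite /exp_coeff/= expr0 divr1 addrC addKr mulr_suml.
  apply: eq_bigr => i _; rewrite /phi_coeff exprS.
  by rewrite -!mulrA [RHS]mulrC !mulrA mulfVK // mulrC.
apply: cvgM; last exact: cvg_cst.
apply: cvgB; last exact: cvg_cst.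
rewrite (cvg_shiftS (series (exp_coeff z))).
exact: is_cvg_series_exp_coeff.
Qed.

Definition mx_phi (d : nat) (A : 'M[R]_d) : 'M[R]_d := mx_pseries phi_coeff A.

End MatrixFunctions.

Section Norms.
Context {R : realType} {d : nat}.

Record vector_norm (N : 'cV[R]_d -> R) : Prop := VectorNorm {
  vnorm_triangle : forall u v, N (u + v) <= N u + N v;
  vnormZ : forall (c : R) u, N (c *: u) = `|c| * N u;
  vnorm0_eq0 : forall u, N u = 0 -> u = 0 }.

Definition op_norm (N : 'cV[R]_d -> R) (A : 'M[R]_d) : R :=
  sup [set N (A *m v) | v in [set v | N v <= 1]].

(* The maxima over [0, T] are attained by continuity, hence equal to sups. *)
Definition M_E (N : 'cV[R]_d -> R) (A : 'M[R]_d) (T : R) : R :=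
  sup [set op_norm N (mx_exp (t *: A)) | t in `[0, T]].

Definition M_phi (N : 'cV[R]_d -> R) (A : 'M[R]_d) (T : R) : R :=
  sup [set op_norm N (mx_phi (t *: A)) | t in `[0, T]].

Definition lipschitz_on_set (N : 'cV[R]_d -> R) (D : set 'cV[R]_d) (L : R)
    (f : 'cV[R]_d -> 'cV[R]_d) : Prop :=
  forall u v, D u -> D v -> N (f u - f v) <= L * N (u - v).

End Norms.

Section EKahan.
Context {R : realType} {d : nat}.
Implicit Types (N : 'cV[R]_d -> R) (A : 'M[R]_d) (f : 'cV[R]_d -> 'cV[R]_d).

(* The derivatives at the endpoints 0 and T are one-sided; the values of x
   outside [0, T] are irrelevant. *)
Definition ode_solution A f (T : R) (x : R -> 'cV[R]_d) : Prop :=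
  forall t, 0 <= t <= T ->
    (s - t)^-1 *: (x s - x t) @[s --> within `[0, T] t^'] -->
      A *m x t + f (x t).

(* Right-hand side of the implicit scheme u' = ekahan_rhs A f h u u'. *)
Definition ekahan_rhs A f (h : R) (u u' : 'cV[R]_d) : 'cV[R]_d :=
  mx_exp (h *: A) *m u +
  h *: (mx_phi (h *: A) *m
    (- (2^-1 *: f u) + 2 *: f (2^-1 *: (u + u')) - 2^-1 *: f u')).

Definition ekahan_solution A f (T h : R) (xn : nat -> 'cV[R]_d) : Prop :=
  forall n, n.+1%:R * h <= T ->
    xn n.+1 = ekahan_rhs A f h (xn n) (xn n.+1).

(* local_error A f x h n is the residual tau_(n+1) on [nh, (n+1)h]. *)
Definition local_error A f (x : R -> 'cV[R]_d) (h : R) (n : nat) : 'cV[R]_d :=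
  x (n.+1%:R * h) - ekahan_rhs A f h (x (n%:R * h)) (x (n.+1%:R * h)).

Record ekahan_assumptions N A f (T L Cloc : R) (x : R -> 'cV[R]_d)
    (D : set 'cV[R]_d) (h : R) (xn : nat -> 'cV[R]_d) : Prop := {
  ekahan_scheme : ekahan_solution A f T h xn;
  ekahan_convex : convex_set D;
  ekahan_bounded : exists M, forall v, D v -> N v <= M;
  ekahan_exact_in : forall t, 0 <= t <= T -> D (x t);
  ekahan_numerical_in : forall n, n%:R * h <= T -> D (xn n);
  ekahan_lipschitz : lipschitz_on_set N D L f;
  ekahan_local_error : forall n, n.+1%:R * h <= T ->
    N (local_error A f x h n) <= Cloc * h ^+ 3 }.

Definition max_error N (T : R) (x : R -> 'cV[R]_d) (h : R)
    (xn : nat -> 'cV[R]_d) : R :=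
  sup [set N (x (n%:R * h) - xn n) | n in [set n | n%:R * h <= T]].

End EKahan.

(* Main.v *)
Require Import Defs.
From HB Require Import structures.
From mathcomp Require Import all_boot all_order all_algebra.
From mathcomp Require Import all_classical all_reals all_analysis.
From mathcomp Require Import lra ring.
Import Order.TTheory GRing.Theory Num.Theory.
Import numFieldNormedType.Exports.

Local Open Scope classical_set_scope.
Local Open Scope ring_scope.

(** Write e_n for the error N (x (t_n) - x_n), a for the operator norm of A and
    Mphi for M_phi N A T.  Subtracting the scheme from the equation defining
    the local error gives

      e_(n+1) <= E * e_n + al * (e_n + e_(n+1)) + |Cloc| * h^3

    with E = exp (h a) and al = 3/2 h Mphi L: each of e_n and e_(n+1) gets L/2
    from the value of f at its own endpoint and 2 * L/2 from the value at the
    midpoint, which is in D by convexity ([ekahan_rhs_dist]).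
    The condition h <= h_0 says exactly that al <= 1/2, so e_(n+1) can be
    absorbed on the left.  As (1 + al) / (1 - al) <= 1 + 4 al <= exp (4 al),
    this yields

      e_(n+1) <= exp (h (a + 6 L Mphi)) * (e_n + 2 |Cloc| h^3)

    ([implicit_step_le], [ekahan_error_step]).  Iterating
    ([discrete_gronwall]), the n-fold product of the exponentials is at most
    exp ((a + 6 L Mphi) T) and the n local errors add up to at most
    2 |Cloc| T h^2, since n h <= T.

    The growth factor of the linear part must be 1 + O(h), whence the bound
    exp (h a) on the norm of mx_exp (h A): the bound M_E, which is independent
    of h, would only give a growth by M_E^n over n steps.

    The analytic input is that mx_exp and mx_phi, defined as limits in the
    entrywise topology, are controlled by the arbitrary norm N.  A seminorm on
    matrices is continuous ([seminorm_continuous]), and a norm dominates the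
    entrywise one by compactness of the unit sphere
    ([mx_norm_le_vector_norm]).  Hence operator norms are finite, and a power
    series whose coefficients lie between 0 and 1/k! converges at every
    matrix B to a matrix of norm at most exp of the norm of B
    ([op_norm_mx_pseries]).  Applied to phi this bounds the set whose supremum
    is M_phi, which makes M_phi an upper bound of it.  Finally M_phi > 0
    because phi (0) is the identity, so h_0 is positive and the estimate holds
    for all small h, whence the O(h^2) statement. *)

(** * Seminorms on matrices *)

(** This makes matrices over the reals a complete normed module, so that
    absolutely convergent series of matrices converge. *)
HB.instance Definition _ (R : realType) (m n : nat) :=
  Complete.on 'M[R]_(m, n).

(** Seminorms, and not only norms, are considered because the maps sending a
    matrix B to N (B *m v) for a fixed v are seminorms. *)
Definition seminorm {R : realType} {V : lmodType R} (p : V -> R) : Prop :=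
  (forall u v, p (u + v) <= p u + p v) /\
  (forall (c : R) u, p (c *: u) = `|c| * p u).

Section SeminormTheory.
Context {R : realType} {V : lmodType R} {p : V -> R} (sp : seminorm p).

Lemma seminorm0 : p 0 = 0.
Proof. by rewrite -(scale0r 0) sp.2 normr0 mul0r. Qed.

Lemma seminormN u : p (- u) = p u.
Proof. by rewrite -scaleN1r sp.2 normrN1 mul1r. Qed.

Lemma seminorm_ge0 u : 0 <= p u.
Proof.
by have := sp.1 u (- u); rewrite subrr seminorm0 seminormN; lra.
Qed.

Lemma seminorm_dist u v : `|p u - p v| <= p (u - v).
Proof.
have h a b : p a - p b <= p (a - b).
  by rewrite lerBlDr -{1}(subrK b a); exact: sp.1.
by rewrite ler_norml h andbT lerNl opprB -(seminormN (u - v)) opprB.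
Qed.

Lemma seminorm_sum (I : Type) (r : seq I) (F : I -> V) :
  p (\sum_(i <- r) F i) <= \sum_(i <- r) p (F i).
Proof.
elim/big_ind2: _ => [|x a y b xa yb|//]; first by rewrite seminorm0.
by apply: le_trans (sp.1 _ _) _; exact: lerD.
Qed.

Lemma seminorm_comp {W : lmodType R} (g : {linear W -> V}) : seminorm (p \o g).
Proof.
by split=> [u v|c u] /=; rewrite ?linearD ?linearZ; [exact: sp.1|exact: sp.2].
Qed.

End SeminormTheory.

Section MatrixNorm.
Context {R : realType} {m n : nat}.
Implicit Types M : 'M[R]_(m, n).

Lemma ler_mx_norm_coord M i j : `|M i j| <= `|M|.
Proof.
rewrite [leRHS]/Num.norm/= mx_normrE.
exact: (le_bigmax _ (fun ij : 'I_m * 'I_n => `|M ij.1 ij.2|) (i, j)).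
Qed.

Lemma mx_norm_le M c : 0 <= c -> (forall i j, `|M i j| <= c) -> `|M| <= c.
Proof.
by move=> c0 Mc; rewrite [leLHS]/Num.norm/= mx_normrE; apply: bigmax_le.
Qed.

(** Expand M in the basis of elementary matrices. *)
Lemma seminorm_le_mx_norm {p : 'M[R]_(m, n) -> R} : seminorm p ->
  exists2 K, 0 < K & forall M, p M <= K * `|M|.
Proof.
move=> sp; exists (1 + \sum_i \sum_j p (delta_mx i j)).
  by rewrite ltr_wpDr ?ltr01//; do 2 (apply: sumr_ge0 => ? _); exact: seminorm_ge0.
move=> M; rewrite mulrDl mul1r; apply: ler_wpDl => //.
rewrite {1}(matrix_sum_delta M) mulr_suml.
apply: le_trans (seminorm_sum sp _ _ _) _; apply: ler_sum => i _.
rewrite mulr_suml; apply: le_trans (seminorm_sum sp _ _ _) _.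
apply: ler_sum => j _; rewrite sp.2 mulrC.
by apply: ler_wpM2l; [exact: seminorm_ge0|exact: ler_mx_norm_coord].
Qed.

(** A seminorm is Lipschitz for the entrywise norm that dominates it. *)
Lemma seminorm_continuous {p : 'M[R]_(m, n) -> R} : seminorm p -> continuous p.
Proof.
move=> sp M; have [K K0 pK] := seminorm_le_mx_norm sp.
apply/(@cvgrPdist_le _ _ _ (nbhs M) (nbhs_filter M)) => e e0; near=> M'.
apply: le_trans (seminorm_dist sp _ _) _; apply: le_trans (pK _) _.
rewrite mulrC -ler_pdivlMr//; near: M'.
by apply: cvgr_dist_le; [exact: cvg_id|exact: divr_gt0].
Unshelve. all: by end_near. Qed.

End MatrixNorm.

Lemma mx_norm_tr {R : realType} {m n : nat} (M : 'M[R]_(m, n)) : `|M^T| = `|M|.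
Proof.
apply/eqP; rewrite eq_le; apply/andP; split; apply: mx_norm_le => // i j.
  by rewrite mxE; exact: ler_mx_norm_coord.
have -> : M i j = M^T j i by rewrite mxE.
exact: ler_mx_norm_coord.
Qed.

(** * Vector norms and operator norms *)

Section VectorNorm.
Context {R : realType} {d : nat} {N : 'cV[R]_d -> R} (vN : vector_norm N).
Implicit Types (A B : 'M[R]_d) (v : 'cV[R]_d).

Lemma vector_norm_seminorm : seminorm N.
Proof. by split=> [u v|c u]; [exact: vnorm_triangle|exact: vnormZ]. Qed.
Let sN := vector_norm_seminorm.

(** The continuous function N attains a minimum on the compact unit sphere of
    the entrywise norm, and this minimum is positive because N is definite.
    The sphere is taken among row vectors, where closed
    bounded sets are compact; it is empty when d = 0. *)
Lemma mx_norm_le_vector_norm : exists2 K, 0 < K & forall v, `|v| <= K * N v.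
Proof.
pose S := [set w : 'rV[R]_d | `|w| = 1].
have S_scaled v : v != 0 -> S (`|v|^-1 *: v^T).
  move=> v0; rewrite /S/= normrZ mx_norm_tr ger0_norm ?invr_ge0//.
  by rewrite mulVf ?normr_eq0.
have [S0|S0] := pselect (S !=set0); last first.
  exists 1 => // v; rewrite mul1r; have [->|v0] := eqVneq v 0.
    by rewrite normr0 seminorm_ge0.
  by exfalso; apply: S0; eexists; exact: S_scaled v0.
have cS : compact S.
  apply: bounded_closed_compact.
    by exists 1; split => // M M1 w Sw; rewrite /= Sw ltW.
  rewrite (_ : S = Num.norm @^-1` [set 1])//.
  by apply: closed_comp => [x _|]; [exact: norm_continuous|exact: closed_eq].
have sg : seminorm (N \o trmx : 'rV[R]_d -> R) := seminorm_comp sN trmx.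
have [w0 /set_mem Sw0 w0min] := compact_EVT_min S0 cS
  (continuous_subspaceT (seminorm_continuous sg)).
have c0 : 0 < N w0^T.
  rewrite lt_neqAle seminorm_ge0// andbT eq_sym; apply/eqP => /(vnorm0_eq0 vN).
  move=> /(congr1 trmx); rewrite trmxK trmx0 => w00.
  by move: Sw0; rewrite /S/= w00 normr0 => /esym/eqP; rewrite oner_eq0.
exists (N w0^T)^-1; first by rewrite invr_gt0.
move=> v; have [->|v0] := eqVneq v 0; first by rewrite normr0 seminorm0// mulr0.
have := w0min _ (mem_set (S_scaled v v0)).
rewrite /= linearZ/= trmxK vnormZ// ger0_norm ?invr_ge0//.
rewrite mulrC ler_pdivlMr ?normr_gt0// => h.
by rewrite mulrC ler_pdivlMr// mulrC.
Qed.

(** Finiteness of the operator norm; the supremum of an unbounded set would be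
    the junk value 0. *)
Lemma op_norm_has_sup A : has_sup [set N (A *m v) | v in [set v | N v <= 1]].
Proof.
split; first by exists (N (A *m 0)), 0 => //=; rewrite seminorm0.
have [K K0 NK] := seminorm_le_mx_norm (seminorm_comp sN (mulmx A)).
have [K' K'0 NK'] := mx_norm_le_vector_norm.
exists (K * K') => _ [v /= v1 <-]; apply: le_trans (NK v) _.
rewrite ler_pM2l//; apply: le_trans (NK' v) _.
by rewrite -[leRHS]mulr1 ler_pM2l.
Qed.

Lemma op_norm_ge0 A : 0 <= op_norm N A.
Proof.
apply: (@le_trans _ _ (N (A *m 0))); first exact: seminorm_ge0.
apply: (sup_upper_bound (op_norm_has_sup A)).
by exists 0 => //=; rewrite seminorm0.
Qed.

Lemma op_normP A v : N (A *m v) <= op_norm N A * N v.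
Proof.
have [->|v0] := eqVneq v 0; first by rewrite mulmx0 seminorm0// mulr0.
have Nv0 : 0 < N v.
  rewrite lt_neqAle seminorm_ge0// andbT eq_sym; apply/eqP => /(vnorm0_eq0 vN).
  by move/eqP; rewrite (negbTE v0).
have : N (A *m ((N v)^-1 *: v)) <= op_norm N A.
  apply: (sup_upper_bound (op_norm_has_sup A)); eexists; last by [].
  by rewrite /= vnormZ// gtr0_norm ?invr_gt0// mulVf ?gt_eqF.
rewrite -scalemxAr vnormZ// gtr0_norm ?invr_gt0//.
by rewrite mulrC ler_pdivrMr.
Qed.

Lemma op_norm_le A c : 0 <= c -> (forall v, N (A *m v) <= c * N v) ->
  op_norm N A <= c.
Proof.
move=> c0 Ac; apply: ge_sup; first by have [] := op_norm_has_sup A.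
move=> _ [v /= v1 <-]; apply: le_trans (Ac v) _.
by rewrite -[leRHS]mulr1 ler_wpM2l.
Qed.

Lemma op_normZ_le (t : R) A : op_norm N (t *: A) <= `|t| * op_norm N A.
Proof.
apply: op_norm_le; first by rewrite mulr_ge0 ?op_norm_ge0.
by move=> v; rewrite -scalemxAl vnormZ// -mulrA ler_wpM2l ?op_normP.
Qed.

Lemma vector_norm_exp A k v : N (A ^+ k *m v) <= op_norm N A ^+ k * N v.
Proof.
elim: k v => [|k IH] v; first by rewrite !expr0 mul1r mul1mx.
rewrite exprS -mulmxA; apply: le_trans (op_normP _ _) _.
by rewrite exprS -mulrA ler_wpM2l// op_norm_ge0.
Qed.

(** The entries of a power of A are coordinates of its values at the basis
    vectors; the constant depends on N only, so that the power series of
    matrices below are dominated by the exponential series. *)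
Lemma mx_norm_exp_le :
  exists2 K, 0 < K & forall A k, `|A ^+ k| <= K * op_norm N A ^+ k.
Proof.
have [K K0 NK] := mx_norm_le_vector_norm.
pose s := 1 + \sum_j N (delta_mx j 0).
have s_ge j : N (delta_mx j 0) <= s.
  rewrite /s (bigD1 j)//= addrCA lerDl addr_ge0//.
  by apply: sumr_ge0 => i _; exact: seminorm_ge0.
have s0 : 0 < s by rewrite ltr_wpDr//; apply: sumr_ge0 => i _; exact: seminorm_ge0.
exists (K * s); first exact: mulr_gt0.
move=> A k; have Ak0 : 0 <= op_norm N A ^+ k by rewrite exprn_ge0 ?op_norm_ge0.
apply: mx_norm_le => [|i j]; first by rewrite !mulr_ge0 // ltW.
have -> : (A ^+ k) i j = (A ^+ k *m delta_mx j 0 : 'cV_d) i 0.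
  by rewrite -colE mxE.
apply: le_trans (ler_mx_norm_coord _ _ _) _; apply: le_trans (NK _) _.
rewrite -mulrA ler_pM2l// mulrC; apply: le_trans (vector_norm_exp _ _ _) _.
exact: ler_wpM2l.
Qed.

(** * Power series of matrices dominated by the exponential *)

Section Pseries.
Context {a : nat -> R} (a_ge0 : forall k, 0 <= a k)
  (a_le : forall k, a k <= k`!%:R^-1).

Lemma is_cvg_mx_pseries A : cvgn (series (fun k => a k *: A ^+ k)).
Proof.
have [K K0 AK] := mx_norm_exp_le.
apply: normed_cvg; apply: (@series_le_cvg _ _ (K *: exp_coeff (op_norm N A))) => /=.
- by [].
- move=> k; apply: mulr_ge0; first exact: ltW.
  by rewrite /exp_coeff/= divr_ge0// exprn_ge0// op_norm_ge0.
- move=> k; rewrite normrZ ger0_norm//.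
  apply: (@le_trans _ _ (k`!%:R^-1 * `|A ^+ k|)); first exact: ler_wpM2r.
  apply: (@le_trans _ _ (k`!%:R^-1 * (K * op_norm N A ^+ k))).
    by rewrite ler_wpM2l ?invr_ge0.
  by rewrite mulrCA [_ * _ ^+ k]mulrC.
- exact/is_cvg_seriesZ/is_cvg_series_exp_coeff.
Qed.

(** The triangle inequality on partial sums, then a passage to the limit
    through the continuous seminorm sending B to N (B *m v). *)
Lemma vector_norm_mx_pseries A v :
  N (mx_pseries a A *m v) <= expR (op_norm N A) * N v.
Proof.
pose S := series (fun k => a k *: A ^+ k).
have sg : seminorm (N \o mulmxr v : 'M[R]_d -> R) := seminorm_comp sN (mulmxr v).
have cvS : (N \o mulmxr v) (S k) @[k --> \oo] --> N (mx_pseries a A *m v).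
  by apply: continuous_cvg; [exact: seminorm_continuous|exact: is_cvg_mx_pseries].
have cvE : series (exp_coeff (op_norm N A)) k * N v @[k --> \oo] -->
    expR (op_norm N A) * N v.
  apply: cvgM; last exact: cvg_cst.
  exact: is_cvg_series_exp_coeff.
apply: ler_cvg_to cvS cvE _; apply: nearW => k /=.
rewrite /S /series/= mulmx_suml mulr_suml; apply: le_trans (seminorm_sum sN _ _ _) _.
apply: ler_sum => i _; rewrite -scalemxAl vnormZ// ger0_norm//.
apply: le_trans (ler_wpM2l (a_ge0 i) (vector_norm_exp A i v)) _.
rewrite mulrA; apply: ler_wpM2r; first exact: seminorm_ge0.
rewrite /exp_coeff/= mulrC; apply: ler_wpM2l => //.
by rewrite exprn_ge0// op_norm_ge0.
Qed.

Lemma op_norm_mx_pseries A : op_norm N (mx_pseries a A) <= expR (op_norm N A).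
Proof. by apply: op_norm_le (vector_norm_mx_pseries A); exact: expR_ge0. Qed.

End Pseries.
End VectorNorm.

Section MatrixExpPhi.
Context {R : realType} {d : nat} {N : 'cV[R]_d -> R} (vN : vector_norm N).
Implicit Types A : 'M[R]_d.

Lemma op_norm_mx_exp A : op_norm N (mx_exp A) <= expR (op_norm N A).
Proof. by apply: (op_norm_mx_pseries vN) => k; rewrite ?invr_ge0. Qed.

Lemma op_norm_mx_phi A : op_norm N (mx_phi A) <= expR (op_norm N A).
Proof.
apply: (op_norm_mx_pseries vN) => k; rewrite /phi_coeff ?invr_ge0//.
by rewrite lef_pV2 ?posrE ?ltr0n ?fact_gt0// ler_nat factS leq_pmull.
Qed.

Lemma mx_phi0 : mx_phi (0 : 'M[R]_d) = 1%:M.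
Proof.
apply: cvg_lim; first exact: norm_hausdorff.
rewrite -cvg_shiftS; apply: cvg_near_cst; apply: nearW => n.
rewrite /series/= big_nat_recl// expr0 big1 ?addr0 => [|i _].
  by rewrite /phi_coeff factS fact0 mul1n invr1 scale1r.
by rewrite exprS mul0r scaler0.
Qed.

(** The set whose supremum is M_phi is bounded by exp (T * op_norm N A). *)
Lemma op_norm_mx_phi_le_M_phi A {T t : R} : 0 <= t <= T ->
  op_norm N (mx_phi (t *: A)) <= M_phi N A T.
Proof.
move=> tT; apply: sup_upper_bound; last by exists t => //=; rewrite in_itv.
split; first by exists (op_norm N (mx_phi (t *: A))), t => //=; rewrite in_itv.
exists (expR (T * op_norm N A)) => _ [s /= sT <-].
move: sT; rewrite in_itv/= => /andP[s0 sT].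
apply: le_trans (op_norm_mx_phi _) _; rewrite ler_expR.
apply: le_trans (op_normZ_le vN _ _) _; rewrite ger0_norm//.
by rewrite ler_wpM2r// op_norm_ge0.
Qed.

(** M_phi is at least the norm of phi (0), the identity, which is nonzero
    since the dimension is positive. *)
Lemma M_phi_gt0 A {T : R} : (0 < d)%N -> 0 <= T -> 0 < M_phi N A T.
Proof.
move=> d0 T0; have sN := vector_norm_seminorm vN.
apply: (@lt_le_trans _ _ (op_norm N (mx_phi (0 *: A)))); last first.
  by apply: op_norm_mx_phi_le_M_phi; rewrite lexx.
rewrite scale0r mx_phi0; pose v : 'cV[R]_d := const_mx 1.
have Nv : 0 < N v.
  rewrite lt_neqAle seminorm_ge0// andbT eq_sym; apply/eqP => /(vnorm0_eq0 vN).
  move=> /matrixP/(_ (Ordinal d0) 0); rewrite !mxE.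
  by move/eqP; rewrite oner_eq0.
have := op_normP vN 1%:M v; rewrite mul1mx -ler_pdivrMr// divff ?gt_eqF//.
exact: lt_le_trans.
Qed.

End MatrixExpPhi.

(** * Scalar recurrences *)

Section Recurrence.
Context {R : realType}.

(** Solving for e' divides by 1 - al, which is at least 1/2; the factor 4 comes
    from 1 + al <= (1 - al) * (1 + 4 * al), valid for 0 <= al <= 1/2. *)
Lemma implicit_step_le (E e e' al c : R) : 1 <= E -> 0 <= e -> 0 <= al <= 2^-1 ->
  0 <= c -> e' <= E * e + al * (e + e') + c ->
  e' <= E * expR (4 * al) * (e + 2 * c).
Proof.
move=> E1 e0 /andP[al0 al2] c0 h.
have e'_le : e' <= E * (1 + 4 * al) * (e + 2 * c).
  have Ee : e <= E * e by rewrite ler_peMl.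
  have Ec : c <= E * c by rewrite ler_peMl.
  have Ee0 : 0 <= E * e by lra.
  have Ec0 : 0 <= E * c by lra.
  have E0 : 0 < 1 - al by lra.
  (* Both sides are now polynomial, with E * e and E * c as unknowns. *)
  rewrite -(ler_pM2l E0).
  apply: (@le_trans _ _ ((1 + al) * (E * e) + E * c)); first nra.
  have h1 : 1 + al <= (1 - al) * (1 + 4 * al) by nra.
  have h2 : 1 <= (1 - al) * (1 + 4 * al) * 2 by nra.
  have := lerD (ler_wpM2r Ee0 h1) (ler_wpM2r Ec0 h2).
  by rewrite mul1r => /le_trans; apply; lra.
apply: le_trans e'_le _; rewrite ler_wpM2r ?addr_ge0 ?mulr_ge0// ler_wpM2l//.
  by rewrite (le_trans ler01).
exact: expR_ge1Dx.
Qed.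

(** With the local contribution c inside the factor q, the n contributions are
    each amplified at most q ^+ n times. *)
Lemma discrete_gronwall (e : nat -> R) (q c : R) (n : nat) :
  1 <= q -> 0 <= c -> (forall k, (k < n)%N -> e k.+1 <= q * (e k + c)) ->
  e n <= q ^+ n * (e 0%N + n%:R * c).
Proof.
move=> q1 c0; elim: n => [|n IH] he; first by rewrite expr0 mul1r mul0r addr0.
have q0 : 0 <= q by lra.
apply: le_trans (he n (leqnn _)) _; rewrite exprS -mulrA ler_wpM2l//.
have := IH (fun k kn => he k (leqW kn)).
have : c <= q ^+ n * c by rewrite ler_peMl// exprn_ege1.
rewrite -natr1 => h1 h2; apply: le_trans (lerD h2 h1) _.
lra.
Qed.

End Recurrence.

(** * Stability and convergence of the scheme *)

Section ConvexMidpoint.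
Context {R : realType} {V : lmodType R}.

Lemma convex_set_midpoint {D : set V} {u v} :
  convex_set D -> D u -> D v -> D (2^-1 *: (u + v)).
Proof.
move=> cD Du Dv.
have h0 : 0 <= (2^-1 : R) by lra.
have h1 : (2^-1 : R) <= 1 by lra.
have := cD u v (Itv01 h0 h1) (mem_set Du) (mem_set Dv) => /set_mem.
rewrite -[X in D X]/(2^-1 *: u + (1 - 2^-1) *: v).
by rewrite (_ : 1 - 2^-1 = 2^-1 :> R) -?scalerDr//; lra.
Qed.
End ConvexMidpoint.

Section EKahanStability.
Context {R : realType} {d : nat} {N : 'cV[R]_d -> R} (vN : vector_norm N).
Context {A : 'M[R]_d} {f : 'cV[R]_d -> 'cV[R]_d} {T L : R} (L_ge0 : 0 <= L).
Context {D : set 'cV[R]_d} (cD : convex_set D) (fL : lipschitz_on_set N D L f).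
Let sN := vector_norm_seminorm vN.

(** Stability of one step.  Each of the two differences enters once through f
    at the corresponding endpoint, with coefficient 1/2, and once through half
    of it in the midpoint, with coefficient 2: in total 1/2 + 1 = 3/2. *)
Lemma ekahan_rhs_dist {h u u' w w'} : 0 <= h <= T -> D u -> D u' -> D w -> D w' ->
  N (ekahan_rhs A f h u u' - ekahan_rhs A f h w w') <=
  expR (h * op_norm N A) * N (u - w) +
  3 / 2 * h * M_phi N A T * L * (N (u - w) + N (u' - w')).
Proof.
move=> hT Du Du' Dw Dw'; have /andP[h0 _] := hT.
pose G (x y : 'cV[R]_d) :=
  - (2^-1 *: f x) + 2 *: f (2^-1 *: (x + y)) - 2^-1 *: f y.
have -> : ekahan_rhs A f h u u' - ekahan_rhs A f h w w' =
    mx_exp (h *: A) *m (u - w) + h *: (mx_phi (h *: A) *m (G u u' - G w w')).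
  have rhsE x y : ekahan_rhs A f h x y =
    mx_exp (h *: A) *m x + h *: (mx_phi (h *: A) *m G x y) by [].
  by rewrite !rhsE (mulmxBr _ u w) (mulmxBr _ (G u u')) scalerBr opprD addrACA.
apply: le_trans (sN.1 _ _) _; apply: lerD.
  apply: le_trans (op_normP vN _ _) _; rewrite ler_wpM2r ?seminorm_ge0//.
  apply: le_trans (op_norm_mx_exp vN _) _; rewrite ler_expR.
  by rewrite -{2}(ger0_norm h0) op_normZ_le.
have NG : N (G u u' - G w w') <= 3 / 2 * L * (N (u - w) + N (u' - w')).
  have -> : G u u' - G w w' = - 2^-1 *: (f u - f w) +
      2 *: (f (2^-1 *: (u + u')) - f (2^-1 *: (w + w'))) - 2^-1 *: (f u' - f w').
    by apply/matrixP => i j; rewrite !mxE; ring.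
  have Nm := fL _ _ (convex_set_midpoint cD Du Du') (convex_set_midpoint cD Dw Dw').
  move: Nm; rewrite -scalerBr opprD addrACA vnormZ// => Nm.
  have Ns := sN.1 (u - w) (u' - w').
  have h2 : `|2^-1 : R| = 2^-1 by rewrite ger0_norm.
  apply: le_trans (sN.1 _ _) _; rewrite seminormN//.
  apply: le_trans (lerD (sN.1 _ _) (lexx _)) _.
  rewrite !vnormZ// normrN h2 (ger0_norm (ler0n _ 2)).
  move: Nm; rewrite h2 => Nm.
  have := ler_wpM2l L_ge0 Ns.
  have := fL _ _ Du Dw; have := fL _ _ Du' Dw'; lra.
rewrite vnormZ// ger0_norm//.
apply: le_trans (ler_wpM2l h0 (op_normP vN _ _)) _.
have hP := op_norm_mx_phi_le_M_phi vN A hT.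
have := ler_pM (op_norm_ge0 vN _) (seminorm_ge0 sN _) hP NG.
move=> /(ler_wpM2l h0) /le_trans; apply.
lra.
Qed.

(** The step condition says that al = 3/2 h Mphi L is at most 1/2, and 4 al is
    the contribution 6 h L Mphi to the exponent. *)
Lemma ekahan_error_step {x xn Cloc h n} :
  0 < h -> ekahan_assumptions N A f T L Cloc x D h xn ->
  3 * L * M_phi N A T * h <= 1 -> n.+1%:R * h <= T ->
  N (x (n.+1%:R * h) - xn n.+1) <=
    expR (h * (op_norm N A + 6 * L * M_phi N A T)) *
    (N (x (n%:R * h) - xn n) + 2 * (`|Cloc| * h ^+ 3)).
Proof.
move=> h0 [sch _ _ xD xnD _ loc] h1 nT.
have nh0 k : 0 <= k%:R * h by rewrite mulr_ge0// ltW.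
have nT' : n%:R * h <= T by rewrite (le_trans _ nT)// ler_pM2r// ler_nat.
have hT : 0 <= h <= T.
  by rewrite ltW//= (le_trans _ nT)// ler_peMl ?ler1n// ltW.
have M0 : 0 <= M_phi N A T.
  exact: le_trans (op_norm_ge0 vN _) (op_norm_mx_phi_le_M_phi vN A hT).
have LM0 : 0 <= L * M_phi N A T * h by rewrite !mulr_ge0// ltW.
have -> : h * (op_norm N A + 6 * L * M_phi N A T) =
  h * op_norm N A + 4 * (3 / 2 * h * M_phi N A T * L) by field.
rewrite expRD; apply: implicit_step_le.
- by rewrite -expR0 ler_expR mulr_ge0 ?op_norm_ge0// ltW.
- exact: seminorm_ge0.
- by apply/andP; split; lra.
- by rewrite mulr_ge0// exprn_ge0// ltW.
have split_err : x (n.+1%:R * h) - xn n.+1 =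
    (ekahan_rhs A f h (x (n%:R * h)) (x (n.+1%:R * h)) -
     ekahan_rhs A f h (xn n) (xn n.+1)) + local_error A f x h n.
  by rewrite -sch// /local_error [RHS]addrC addrA subrK.
rewrite {1}split_err; apply: le_trans (sN.1 _ _) _; apply: lerD.
  apply: le_trans (ekahan_rhs_dist hT _ _ _ _) _ => //.
  - by apply: xD; rewrite nh0.
  - by apply: xD; rewrite nh0.
  - exact: xnD.
  - exact: xnD.
apply: le_trans (loc _ nT) _.
by rewrite ler_wpM2r ?ler_norm// exprn_ge0// ltW.
Qed.

End EKahanStability.

Theorem theorem1 (R : realType) :
  exists C1 C2 : R -> R -> R -> R -> R -> R -> R,
    (forall a L T mE mphi Cloc : R,
       0 < C1 a L T mE mphi Cloc /\ 0 < C2 a L T mE mphi Cloc) /\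
    forall (d : nat) (N : 'cV[R]_d -> R) (A : 'M[R]_d)
      (f : 'cV[R]_d -> 'cV[R]_d) (T L Cloc : R) (x : R -> 'cV[R]_d),
      (0 < d)%N -> vector_norm N -> 0 < T -> 0 < L -> ode_solution A f T x ->
      (forall (D : set 'cV[R]_d) (h : R) (xn : nat -> 'cV[R]_d),
         0 < h ->
         ekahan_assumptions N A f T L Cloc x D h xn ->
         h <= 1 / (3 * L * M_phi N A T) ->
         forall n : nat, n%:R * h <= T ->
           N (x (n%:R * h) - xn n) <=
             expR (C1 (op_norm N A) L T (M_E N A T) (M_phi N A T) Cloc * T) *
             (N (x 0 - xn 0%N) +
              C2 (op_norm N A) L T (M_E N A T) (M_phi N A T) Cloc * h ^+ 2)) /\
      (forall (D : R -> set 'cV[R]_d) (X : R -> nat -> 'cV[R]_d),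
         (\forall h \near 0^'+,
            ekahan_assumptions N A f T L Cloc x (D h) h (X h) /\
            X h 0%N = x 0) ->
         (fun h : R => max_error N T x h (X h)) =O_ (0^'+) (fun h : R => h ^+ 2)).
Proof.
(* Absolute values and the added 1 only serve positivity for all arguments. *)
exists (fun a L T mE mphi Cloc => `|a| + 6 * (`|L| * `|mphi|) + 1).
exists (fun a L T mE mphi Cloc => 2 * (`|Cloc| * `|T|) + 1).
split=> [a L T mE mphi Cloc|d N A f T L Cloc x d0 vN T0 L0 _].
  by split; rewrite ltr_wpDl ?ltr01// ?addr_ge0// mulr_ge0// mulr_ge0.
have sN := vector_norm_seminorm vN.
have M0 := M_phi_gt0 vN A d0 (ltW T0).
have a0 := op_norm_ge0 vN A.
set C1 := `|op_norm N A| + _ + 1; set C2 := 2 * _ + 1.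
have C20 : 0 < C2 by rewrite ltr_wpDl// mulr_ge0// mulr_ge0.
have error_bound D h xn : 0 < h ->
    ekahan_assumptions N A f T L Cloc x D h xn ->
    h <= 1 / (3 * L * M_phi N A T) -> forall n : nat, n%:R * h <= T ->
    N (x (n%:R * h) - xn n) <= expR (C1 * T) * (N (x 0 - xn 0%N) + C2 * h ^+ 2).
  move=> h0 H hle n nT.
  have h1 : 3 * L * M_phi N A T * h <= 1.
    by rewrite mulrC -ler_pdivlMr ?mulr_gt0.
  set K := op_norm N A + 6 * L * M_phi N A T.
  have K0 : 0 <= K by rewrite addr_ge0// !mulr_ge0// ltW.
  have c0 : 0 <= 2 * (`|Cloc| * h ^+ 3).
    by rewrite mulr_ge0// mulr_ge0// exprn_ge0// ltW.
  have := @discrete_gronwall R (fun k => N (x (k%:R * h) - xn k))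
    (expR (h * K)) (2 * (`|Cloc| * h ^+ 3)) n.
  rewrite /= mul0r => /(_ _ c0) step.
  apply: le_trans (step _ _) _.
  - by rewrite -expR0 ler_expR mulr_ge0// ltW.
  - move=> k kn; case: (H) => _ cD _ _ _ fL _.
    apply: (ekahan_error_step vN (ltW L0) cD fL h0 H h1).
    by rewrite (le_trans _ nT)// ler_pM2r// ler_nat.
  apply: ler_pM; rewrite ?exprn_ge0 ?expR_ge0//.
  - by rewrite addr_ge0 ?(seminorm_ge0 sN)// mulr_ge0.
  - rewrite -expRM_natl ler_expR mulrA mulrC.
    apply: ler_pM => //; first by rewrite mulr_ge0// ltW.
    rewrite /C1 /K (ger0_norm a0) (ger0_norm (ltW L0)) (ger0_norm (ltW M0)); lra.
  rewrite lerD2l; have h2 : 0 <= h ^+ 2 by rewrite exprn_ge0// ltW.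
  have -> : n%:R * (2 * (`|Cloc| * h ^+ 3)) = (2 * (`|Cloc| * (n%:R * h))) * h ^+ 2.
    by ring.
  rewrite ler_wpM2r// /C2 (ger0_norm (ltW T0)).
  have := ler_wpM2l (normr_ge0 Cloc) nT; lra.
split=> // D X HX.
apply/eqO_exP; exists (expR (C1 * T) * C2); first by rewrite mulr_gt0 ?expR_gt0.
have h0_gt0 : 0 < 1 / (3 * L * M_phi N A T) by rewrite divr_gt0// !mulr_gt0.
near=> h.
have h0 : 0 < h by near: h; exact: nbhs_right_gt.
have hle : h <= 1 / (3 * L * M_phi N A T) by near: h; exact: nbhs_right_le.
have [H X0] : ekahan_assumptions N A f T L Cloc x (D h) h (X h) /\ X h 0%N = x 0.
  by near: h.
have err n : n%:R * h <= T -> N (x (n%:R * h) - X h n) <= expR (C1 * T) * C2 * h ^+ 2.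
  move=> /(error_bound (D h) h (X h) h0 H hle); rewrite X0 subrr seminorm0//.
  by rewrite add0r mulrA.
pose S := [set N (x (n%:R * h) - X h n) | n in [set n | n%:R * h <= T]].
have S0 : S (N (x (0%:R * h) - X h 0%N)).
  by exists 0%N => //=; rewrite mul0r ltW.
have ubS : ubound S (expR (C1 * T) * C2 * h ^+ 2).
  by move=> _ [n /= nT <-]; exact: err.
have max_ge0 : 0 <= max_error N T x h (X h).
  apply: (@le_trans _ _ (N (x (0%:R * h) - X h 0%N))); first exact: seminorm_ge0.
  apply: sup_upper_bound; last exact: S0.
  by split; eexists; [exact: S0|exact: ubS].
rewrite !ger0_norm ?exprn_ge0 ?(ltW h0)//.
by apply: ge_sup; [eexists; exact: S0|exact: ubS].
Unshelve. all: by end_near. Qed.
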